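(* Let $n$ be a positive integer with $n\equiv 0$ or $8 \pmod{24}$. Then there exists a near-minimal configuration $(2,4)$ $GDD\left(n,2,6;\frac{7n}{4},2(n-1)\right)$.
   Context: A $GDD(n,2,6;\lambda_1,\lambda_2)$ is a finite collection (repetitions allowed) of $6$-element subsets, called blocks, of a $2n$-element set $X$ partitioned into two groups of size $n$, such that every point lies in the same number $r$ of blocks, any two distinct points of the same group lie together in exactly $\lambda_1$ blocks, and any two points from different groups lie together in exactly $\lambda_2$ blocks. It has configuration $(2,4)$ if every block has exactly $2$ points in one of the two groups and $4$ points in the other (which group contains the $2$ points may depend on the block). The minimal indices for configuration $(2,4)$ and a given $n$ are the smallest positive integers $\lambda_1,\lambda_2$ such that $\lambda_2=\frac{8\lambda_1(n-1)}{7n}$, the number of blocks $\frac{\lambda_1 n(n-1)+\lambda_2n^2}{15}$ is an even integer, and $r=\frac{\lambda_1(n-1)+\lambda_2 n}{5}$ is an integer. A configuration $(2,4)$ GDD is near-minimal if its indices are exactly twice the minimal indices.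
   Formalization: Existence of the configuration (2,4) GDD is proved for all stated n, but near-minimality only when 7 does not divide n-1; when 7 divides n-1 it is false, e.g. for n=8 the minimal indices are (1,1), so (14,14) is not near-minimal. *)

(* Defs.v *)
From mathcomp Require Import all_boot.

Set Implicit Arguments.
Unset Strict Implicit.
Unset Printing Implicit Defensive.

(* GDD(n,m,k;l1,l2) on the point set T: the groups are the members of the
   partition G of T, and the blocks form the list D, since a block may be
   repeated. *)
Definition is_gdd (n m k l1 l2 : nat) (T : finType)
    (G : {set {set T}}) (D : seq {set T}) : Prop :=
  [/\ partition G [set: T] /\ #|G| = m,
      forall g : {set T}, g \in G -> #|g| = n,
      forall b : {set T}, b \in D -> #|b| = k,
      exists r : nat, forall x : T, count (fun b : {set T} => x \in b) D = r
    & forall x y : T, x != y ->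
      count (fun b : {set T} => (x \in b) && (y \in b)) D
        = if pblock G x == pblock G y then l1 else l2].

Definition has_configuration (s t : nat) (T : finType)
    (G : {set {set T}}) (D : seq {set T}) : Prop :=
  forall b : {set T}, b \in D ->
  exists g h : {set T},
    [/\ g \in G, h \in G, g != h, #|b :&: g| = s & #|b :&: h| = t].

(* The equation l2 = 8 l1 (n-1) / (7n) is exact, so it is stated with the
   denominator cleared; this needs 0 < n. *)
Definition admissible24 (n l1 l2 : nat) : Prop :=
  let pairs := l1 * n * (n - 1) + l2 * n ^ 2 in
  [/\ 0 < l1, 0 < l2,
      7 * n * l2 = 8 * l1 * (n - 1),
      15 %| pairs /\ ~~ odd (pairs %/ 15)
    & 5 %| l1 * (n - 1) + l2 * n].

Definition minimal_indices24 (n l1 l2 : nat) : Prop :=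
  admissible24 n l1 l2 /\
  forall m1 m2 : nat, admissible24 n m1 m2 -> l1 <= m1 /\ l2 <= m2.

(* If n = 8 modulo 56 then 8(n-1)/(7n) reduces further: the minimal indices
   are n/8 and (n-1)/7, not 7n/8 and n-1; for instance 1 and 1 when n = 8.
   For such n the indices 7n/4 and 2(n-1) are not near-minimal. *)
Definition near_minimal24 (n l1 l2 : nat) : Prop :=
  exists m1 m2 : nat,
    [/\ minimal_indices24 n m1 m2, l1 = 2 * m1 & l2 = 2 * m2].

(* Main.v *)
Require Import Defs.
From mathcomp Require Import all_boot.
From mathcomp Require Import all_algebra zify ring.

(* Write n = 2h with h even, let m = n - 1 (coprime to 6), and let each group be
   Z_m with a point oo added. Start from the h edges {oo,0}, {i,-i}, whose
   translates form a 1-factorization of the complete graph on a group, and from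
   the h quadruples {oo,0,1,2}, {oo,0,1,3}, {0,j,2j,3j} with 2 <= j < h. The
   progressions with 1 <= j < h cover every difference 3 + 2 + 1 times, and the
   two quadruples through oo make up for the missing j = 1, so the translates of
   the quadruples form a 2-(n,4,6) design.
   For all i, j < h and t in Z_m, place the i-th edge and the j-th quadruple in
   different groups according to the parity of i + j, and translate the group
   "true" by t and the group "false" by -t. Each row and column of this
   checkerboard is balanced, so a pair inside a group lies in h/2 * (1 + 6) = 7n/4
   blocks. For points x, y of different groups, the substitution
   t -> x - y - t exchanges the roles of the two groups, so the blocks
   through x and y are as many as if all edges were on the side of x: the edge
   through x is then unique for each t, and y lies in 2m quadruples. *)

Set Implicit Arguments.
Unset Strict Implicit.
Unset Printing Implicit Defensive.

Import GRing.Theory.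

(** * Sums of indicators and checkerboard sums *)

Lemma sum_eq_op (T : finType) (a : T) : \sum_(x : T) (x == a) = 1.
Proof. by rewrite (bigD1 a) //= eqxx big1 // => x /negbTE ->. Qed.

Lemma mem_sum_eq (T : eqType) (s : seq T) (x : T) :
  uniq s -> (x \in s) = \sum_(a <- s) (x == a) :> nat.
Proof.
move=> us; rewrite -(count_uniq_mem x us) -sum1_count big_mkcond /=.
by apply: eq_bigr => a _; rewrite eq_sym; case: eqP.
Qed.

Lemma sum_parity (b : bool) (l i : nat) :
  \sum_(j < l.*2) (b == odd (i + j)) = l.
Proof.
elim: l => [|l IHl]; first by rewrite big_ord0.
rewrite doubleS !big_ord_recr /= IHl addnS /=.
by clear IHl; case: b; case: (odd _) => /=; lia.
Qed.

(** Every row and every column has [l] cells of each parity, so each [f i] and each [g j] is counted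
    [l] times. *)
Lemma sum_checkerboard (b : bool) (h l : nat) (f g : nat -> nat) : h = l.*2 ->
  \sum_(i < h) \sum_(j < h) (if b == odd (i + j) then f i else g j)
  = l * (\sum_(i < h) f i + \sum_(j < h) g j).
Proof.
move=> ->.
have -> : \sum_(i < l.*2) \sum_(j < l.*2) (if b == odd (i + j) then f i else g j)
  = \sum_(i < l.*2) \sum_(j < l.*2) (b == odd (i + j)) * f i +
    \sum_(j < l.*2) \sum_(i < l.*2) (~~ b == odd (j + i)) * g j.
  rewrite [X in _ = _ + X]exchange_big -big_split; apply: eq_bigr => i _ /=.
  rewrite -big_split; apply: eq_bigr => j _ /=.
  by rewrite (addnC j); case: b; case: (odd _); rewrite /= ?mul1n ?mul0n ?addn0.
rewrite mulnDr !big_distrr /=; congr (_ + _); apply: eq_bigr => i _;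
  by rewrite -big_distrl sum_parity.
Qed.

(** * Base edges, base quadruples and blocks over Z_m *)

(** Here h = q + 2 and m = 2q + 3; the successor form makes it visible that m > 1, so that this is
    the ring of residues modulo m. *)
Notation cyc q := 'Z_(q.*2.+3).

Section Blocks.
Local Open Scope ring_scope.

(* [None] is the point at infinity. *)
Definition shift (q : nat) (t : cyc q) : option (cyc q) -> option (cyc q) :=
  omap (fun z => z + t).

Definition edge (q i : nat) : seq (option (cyc q)) :=
  [:: if i == 0%N then None else Some (- i%:R); Some i%:R].

(* The first branch is {oo, 0, 1, 2} for j = 0 and {oo, 0, 1, 3} for j = 1. *)
Definition quad (q j : nat) : seq (option (cyc q)) :=
  if (j < 2)%N then [:: None; Some 0; Some 1; Some (j.+2)%:R]
  else [:: Some 0; Some j%:R; Some (2 * j%:R); Some (3 * j%:R)].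

(** Membership is tested by undoing the translation, hence [- t] on the side [true], which is moved
    by [t]. *)
Definition block (q : nat) (w : 'I_q.+2 * 'I_q.+2 * cyc q) :
    {set bool * option (cyc q)} :=
  let: (i, j, t) := w in
  [set p | shift (if p.1 then - t else t) p.2
             \in if p.1 == odd (i + j) then edge q i else quad q j].

Lemma natr_small (q j : nat) : (j < q.*2.+3)%N -> (j%:R : cyc q) = j :> nat.
Proof. by move=> hj; rewrite val_Zp_nat // modn_small. Qed.

Lemma natr_eq (q i j : nat) : (i < q.*2.+3)%N -> (j < q.*2.+3)%N ->
  (i%:R == j%:R :> cyc q) = (i == j).
Proof. by move=> hi hj; rewrite -val_eqE /= !natr_small. Qed.

Lemma unit2 (q : nat) : (2 : cyc q) \is a GRing.unit.
Proof. by rewrite unitZpE // -[_.*2.+3]/(q.*2.+1.+2) coprimen2 /= odd_double. Qed.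

Lemma unit3 (q : nat) : coprime q.*2.+3 3 -> (3 : cyc q) \is a GRing.unit.
Proof. by move=> h; rewrite unitZpE. Qed.

Lemma natr_neq0 (q j : nat) : (0 < j < q.*2.+3)%N -> (j%:R : cyc q) != 0.
Proof.
move=> /andP[j0 jm]; apply/eqP => /(congr1 (@nat_of_ord _)).
by rewrite natr_small //= => j00; rewrite j00 in j0.
Qed.

Lemma unitM_neq0 (R : unitRingType) (c x : R) :
  c \is a GRing.unit -> x != 0 -> c * x != 0.
Proof. by move=> uc; apply: contraNneq => cx0; rewrite -(mulKr uc x) cx0 mulr0. Qed.

(** The residues 1, ..., q + 1 and their negatives are the nonzero elements of Z_m, each once, and
    multiplication by the unit [c] permutes these. *)
Lemma sum_half_system (q : nat) (c d : cyc q) :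
  c \is a GRing.unit -> d != 0 ->
  (\sum_(j < q.+1) ((d == c * j.+1%:R)%R + (d == - (c * j.+1%:R))%R) = 1)%N.
Proof.
move=> uc d0.
have [u -> u0] : exists2 u, d = c * u & u != 0.
  exists (c^-1 * d); first by rewrite mulVKr.
  by apply: unitM_neq0; rewrite ?unitrV.
have sgn j : ((c * u == c * j.+1%:R) = (u == j.+1%:R)) *
             ((c * u == - (c * j.+1%:R)) = (u == - j.+1%:R)).
  by rewrite -mulrN !(inj_eq (mulrI uc)).
under eq_bigr => j _ do rewrite !sgn.
have um : (u < q.*2.+3)%N by apply: ltn_ord.
have u_gt0 : (0 < nat_of_ord u)%N.
  by rewrite lt0n; apply: contraNneq u0 => u0; apply/eqP/val_inj.
have eqp j : (j < q.+1)%N -> (u == j.+1%:R) = (j == u.-1)%N.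
  move=> jq; rewrite -val_eqE /= natr_small; lia.
have eqm j : (j < q.+1)%N -> (u == - j.+1%:R) = (j == (q.*2.+3 - u).-1)%N.
  move=> jq; rewrite -addr_eq0 -val_eqE /=.
  rewrite natr_small; last by lia.
  rewrite -[X in (_ %% X)%N]/(q.*2.+3).
  apply/eqP/eqP => /=; last first.
    by move=> ->; rewrite (_ : (_ + _)%N = q.*2.+3) ?modnn //; lia.
  (* The sum [u + j.+1] lies strictly between 0 and 2m, so the quotient is 1. *)
  move/eqP; rewrite -/(dvdn _ _) => /dvdnP[[|[|k]]]; lia.
under eq_bigr => j _ do rewrite eqp // eqm //.
have key a : (a < q.+1)%N -> (\sum_(j < q.+1) (nat_of_ord j == a) = 1)%N.
  by move=> aq; rewrite -[RHS](sum_eq_op (Ordinal aq)).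
have key0 a : (q.+1 <= a)%N -> (\sum_(j < q.+1) (nat_of_ord j == a) = 0)%N.
  by move=> aq; rewrite big1 // => j _; have := ltn_ord j; case: eqP => //; lia.
(* The two candidate indices add up to 2q + 1, so exactly one of them is at most q. *)
rewrite big_split /=; case: (ltnP u.-1 q.+1) => h.
  by rewrite key // key0 //; lia.
by rewrite key0 // key //; lia.
Qed.

Lemma uniq_edge (q i : nat) : (i < q.+2)%N -> uniq (edge q i).
Proof.
case: i => [|i] iq //=; rewrite inE andbT.
rewrite (inj_eq Some_inj) eq_sym -addr_eq0 -mulr2n -(mulr_natl _ 2).
by apply: unitM_neq0; [exact: unit2 | apply: natr_neq0; lia].
Qed.

Lemma uniq_quad (q j : nat) :
  coprime q.*2.+3 3 -> (0 < q)%N -> (j < q.+2)%N -> uniq (quad q j).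
Proof.
move=> cop3 q0 jq; rewrite /quad; case: ltnP => j2.
  rewrite /= !inE !(inj_eq Some_inj) /= andbT.
  rewrite -[1]/(1%:R : cyc q) -[0]/(0%:R : cyc q) !natr_eq; lia.
have j0 : (j%:R : cyc q) != 0 by apply: natr_neq0; lia.
have j20 := unitM_neq0 (unit2 q) j0.
have j30 := unitM_neq0 (unit3 cop3) j0.
rewrite /= !inE !(inj_eq Some_inj) /= andbT !(eq_sym 0).
rewrite (negbTE j0) (negbTE j20) (negbTE j30) /=.
rewrite -!(subr_eq0 j%:R) -(subr_eq0 (2 * _)).
have -> : j%:R - 2 * j%:R = - j%:R :> cyc q by ring.
have -> : j%:R - 3 * j%:R = - (2 * j%:R) :> cyc q by ring.
have -> : 2 * j%:R - 3 * j%:R = - j%:R :> cyc q by ring.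
by rewrite !oppr_eq0 (negbTE j0) (negbTE j20).
Qed.
End Blocks.

(** * Translates of a base set through a given pair: the method of differences *)

Definition difference_is (q : nat) (d : cyc q) (a b : option (cyc q)) : bool :=
  if a is Some u then if b is Some v then d == (u - v)%R else false else false.

Definition pair_count (q : nat) (s : seq (option (cyc q)))
    (u v : option (cyc q)) : nat :=
  \sum_t ((shift t u \in s) && (shift t v \in s)).

Lemma shift_some_eq (q : nat) (t y z : cyc q) :
  (shift t (Some y) == Some z) = (t == z - y)%R.
Proof.
by rewrite (inj_eq Some_inj) -subr_eq0 -[RHS]subr_eq0; congr (_ == _); ring.
Qed.

Lemma sum_shift_some (q : nat) (s : seq (option (cyc q))) (y : cyc q) :
  uniq s -> \sum_t (shift t (Some y) \in s) = count isSome s.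
Proof.
move=> us; under eq_bigr => t _ do rewrite (mem_sum_eq _ us).
rewrite exchange_big -sum1_count [RHS]big_mkcond /=.
apply: eq_bigr => -[z|] _ /=; last by rewrite big1.
rewrite -[RHS](sum_eq_op (z - y)%R); apply: eq_bigr => t _.
by rewrite shift_some_eq.
Qed.

Lemma sum_shift_none (q : nat) (s : seq (option (cyc q))) :
  \sum_(t : cyc q) (shift t None \in s) = q.*2.+3 * (None \in s).
Proof. by rewrite /shift /= sum_nat_const card_ord. Qed.

(** A translation taking [x], [y] to finite elements u, v of [s] exists only if u - v = x - y, and
    is then the one by u - x. *)
Lemma pair_count_some (q : nat) (s : seq (option (cyc q))) (x y : cyc q) :
  uniq s -> pair_count s (Some x) (Some y) =
            \sum_(a <- s) \sum_(b <- s) difference_is (x - y)%R a b.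
Proof.
move=> us; rewrite /pair_count.
under eq_bigr => t _ do
  rewrite -mulnb !(mem_sum_eq _ us) big_distrlr.
rewrite exchange_big /=; apply: eq_bigr => a _.
rewrite exchange_big /=; apply: eq_bigr => b _.
case: a b => [u|] [v|] /=; try by rewrite big1 // => t _; rewrite ?muln0.
case: eqP => [e|ne]; last first.
  rewrite big1 // => t _; rewrite mulnb; apply/eqP; rewrite eqb0.
  apply/negP => /andP[/eqP[eu] /eqP[ev]]; apply: ne; rewrite -eu -ev; ring.
rewrite -[RHS](sum_eq_op (u - x)%R); apply: eq_bigr => t _; rewrite mulnb.
rewrite -[Some (x + t)%R]/(shift t (Some x)) shift_some_eq.
case: eqP => //= ->; rewrite (_ : y + (u - x) = v)%R ?eqxx //.
have -> : v = (u - (x - y))%R by rewrite e; ring.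
ring.
Qed.

Lemma pair_countC (q : nat) (s : seq (option (cyc q))) (u v : option (cyc q)) :
  pair_count s u v = pair_count s v u.
Proof. by apply: eq_bigr => t _; rewrite andbC. Qed.

Lemma pair_count_none (q : nat) (s : seq (option (cyc q))) (y : cyc q) :
  uniq s -> pair_count s None (Some y) = (None \in s) * count isSome s.
Proof.
by move=> us; rewrite -(sum_shift_some y us) big_distrr /=; apply: eq_bigr => t _; rewrite mulnb.
Qed.

(** * The 1-factorization and the 2-design *)

Lemma none_in_edge (q i : nat) : (None \in edge q i) = (i == 0).
Proof. by case: i. Qed.

Lemma none_in_quad (q j : nat) : (None \in quad q j) = (j < 2).
Proof. by rewrite /quad; case: ltnP. Qed.

Lemma count_edge (q i : nat) : count isSome (edge q i) = 2 - (i == 0).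
Proof. by case: i. Qed.

Lemma count_quad (q j : nat) : count isSome (quad q j) = 4 - (j < 2).
Proof. by rewrite /quad; case: ltnP. Qed.

(** The base edges form a perfect matching: 0 is matched with infinity, and any other residue is i
    or -i for a unique i with 0 < i < h. *)
Lemma sum_mem_edge (q : nat) (u : option (cyc q)) :
  \sum_(i < q.+2) (u \in edge q i) = 1.
Proof.
rewrite big_ord_recl /=; case: u => [z|]; last first.
  by rewrite big1 // => i _; rewrite none_in_edge.
case: (eqVneq z 0%R) => [->|z0].
  rewrite big1 // => i _; rewrite /= !inE !(inj_eq Some_inj) !(eq_sym 0%R) oppr_eq0.
  rewrite (negbTE (natr_neq0 _)) //; have := ltn_ord i; rewrite /bump /=; lia.
rewrite !inE /= (inj_eq Some_inj) (negbTE z0) add0n -[RHS](sum_half_system (unitr1 _) z0).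
apply: eq_bigr => i _; rewrite mem_sum_eq; last first.
  by apply: uniq_edge; have := ltn_ord i; rewrite /= /bump; lia.
by rewrite !big_cons big_nil /= addn0 !(inj_eq Some_inj) mul1r addnC.
Qed.

(** The edge {i, -i} has the differences 2i and -2i, and 2 is a unit, so each nonzero difference
    occurs once. Pairs through infinity come from the edge {oo, 0} alone. *)
Lemma sum_pair_count_edge (q : nat) (u v : option (cyc q)) :
  u != v -> \sum_(i < q.+2) pair_count (edge q i) u v = 1.
Proof.
have none y : \sum_(i < q.+2) pair_count (edge q i) None (Some y) = 1.
  under eq_bigr => i _ do
    rewrite (pair_count_none _ (uniq_edge (ltn_ord i))) none_in_edge count_edge.
  by rewrite big_ord_recl big1.
case: u v => [x|] [y|] // xy; last first.
  by under eq_bigr => i _ do rewrite pair_countC; exact: none.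
have d0 : (x - y)%R != 0%R by rewrite subr_eq0; apply: contraNneq xy => ->.
under eq_bigr => i _ do rewrite (pair_count_some _ _ (uniq_edge (ltn_ord i))).
rewrite -[RHS](sum_half_system (unit2 q) d0) [LHS]big_ord_recl /= /edge.
rewrite !(big_cons, big_nil) /= subrr (negbTE d0) !add0n.
apply: eq_bigr => i _.
rewrite !(big_cons, big_nil) /= !subrr (negbTE d0) !addn0 !add0n /bump /= add1n.
have -> : (- i.+1%:R - i.+1%:R = - (2 * i.+1%:R) :> cyc q)%R by ring.
have -> : (i.+1%:R - - i.+1%:R = 2 * i.+1%:R :> cyc q)%R by ring.
exact: addnC.
Qed.

Lemma sum_pair_count_quad (q : nat) (u v : option (cyc q)) :
  coprime q.*2.+3 3 -> 0 < q ->
  u != v -> \sum_(j < q.+2) pair_count (quad q j) u v = 6.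
Proof.
move=> cop3 q0.
have uq := uniq_quad cop3 q0.
(* Two quadruples contain infinity, each with three finite points. *)
have none y : \sum_(j < q.+2) pair_count (quad q j) None (Some y) = 6.
  under eq_bigr => i _ do
    rewrite (pair_count_none _ (uq _ (ltn_ord i))) none_in_quad count_quad.
  by rewrite !big_ord_recl big1.
case: u v => [x|] [y|] // xy; last first.
  by under eq_bigr => i _ do rewrite pair_countC; exact: none.
have : (x - y)%R != 0%R by rewrite subr_eq0; apply: contraNneq xy => ->.
under eq_bigr => i _ do rewrite (pair_count_some _ _ (uq _ (ltn_ord i))).
move: (x - y)%R => d d0.
pose f (c : cyc q) (j : nat) : nat := (d == c * j%:R)%R + (d == - (c * j%:R))%R.
(* A progression of step j has the differences j, 2j, 3j, up to sign, with multiplicities 3, 2,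
   1. *)
pose g j := 3 * f 1%R j + 2 * f 2%R j + f 3%R j.
have sumg : \sum_(j < q.+1) g j.+1 = 6.
  rewrite 2!big_split -!big_distrr /=.
  by rewrite !sum_half_system ?unitr1 ?unit2 ?unit3.
(* The finite parts {0, 1, 2} and {0, 1, 3} have together the differences of {0, 1, 2, 3}, which is
   the term [g 1]. *)
rewrite -sumg !big_ord_recl addnA; congr (_ + _).
  rewrite /quad !(big_cons, big_nil) /= !subrr !sub0r !subr0 (negbTE d0) /g /f /= !mulr1.
  have -> : (1 - 2 = -1 :> cyc q)%R by ring.
  have -> : (2 - 1 = 1 :> cyc q)%R by ring.
  have -> : (1 - 3 = - 2 :> cyc q)%R by ring.
  have -> : (3 - 1 = 2 :> cyc q)%R by ring.
  rewrite -[(bump 0 0).+2]/3.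
  by do 6!case: (d == _)%R.
apply: eq_bigr => i _; 
rewrite (_ : nat_of_ord (lift ord0 (lift ord0 (i : 'I_q))) = i.+2) //.
rewrite (_ : nat_of_ord (lift ord0 (i : 'I_q)) = i.+1) //.
rewrite /quad /= !(big_cons, big_nil) /= /g /f.
set j := (i.+2%:R)%R.
have -> : (j - 2 * j = - j :> cyc q)%R by ring.
have -> : (2 * j - j = j :> cyc q)%R by ring.
have -> : (j - 3 * j = - (2 * j) :> cyc q)%R by ring.
have -> : (3 * j - j = 2 * j :> cyc q)%R by ring.
have -> : (2 * j - 3 * j = - j :> cyc q)%R by ring.
have -> : (3 * j - 2 * j = j :> cyc q)%R by ring.
rewrite !subrr !sub0r !subr0 (negbTE d0) !mul1r.
by do 6!case: (d == _)%R.
Qed.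

Lemma sum_shift_edge (q : nat) (u : option (cyc q)) :
  \sum_(i < q.+2) \sum_t (shift t u \in edge q i) = q.*2.+3.
Proof.
rewrite exchange_big; under eq_bigr => t _ do rewrite sum_mem_edge.
by rewrite sum1_card card_ord.
Qed.

(** A finite point gives 3 + 3 + 4q = 2m; infinity gives m for each of the two quadruples through
    it. *)
Lemma sum_shift_quad (q : nat) (u : option (cyc q)) :
  coprime q.*2.+3 3 -> 0 < q ->
  \sum_(j < q.+2) \sum_t (shift t u \in quad q j) = q.*2.+3.*2.
Proof.
move=> cop3 q0; case: u => [y|].
  under eq_bigr => j _ do
    rewrite (sum_shift_some _ (uniq_quad cop3 q0 (ltn_ord j))) count_quad.
  by rewrite !big_ord_recl sum_nat_const card_ord /=; lia.
under eq_bigr => j _ do rewrite sum_shift_none none_in_quad.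
by rewrite !big_ord_recl big1 //=; lia.
Qed.

(** * Counting blocks through two points *)

Lemma sum_signed (q : nat) (b : bool) (F : cyc q -> nat) :
  \sum_t F (if b then - t else t)%R = \sum_t F t.
Proof. by case: b; rewrite // [RHS](reindex_inj oppr_inj). Qed.

Lemma count_blocks (q : nat) (p : pred {set bool * option (cyc q)}) :
  count p [seq block w | w <- enum {: 'I_q.+2 * 'I_q.+2 * cyc q}] =
  \sum_(i < q.+2) \sum_(j < q.+2) \sum_t p (block (i, j, t)).
Proof.
rewrite count_map -sum1_count big_mkcond big_enum /= pair_bigA pair_bigA /=.
by apply: eq_bigr => -[[i j] t] _.
Qed.

Lemma count_blocks_same (q l : nat) (b : bool) (u v : option (cyc q)) :
  q.+2 = l.*2 ->
  count (fun B : {set bool * option (cyc q)} => ((b, u) \in B) && ((b, v) \in B))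
    [seq block w | w <- enum {: 'I_q.+2 * 'I_q.+2 * cyc q}] =
  l * (\sum_(i < q.+2) pair_count (edge q i) u v +
       \sum_(j < q.+2) pair_count (quad q j) u v).
Proof.
move=> ql; rewrite count_blocks -(sum_checkerboard b (fun i => pair_count (edge q i) u v)
  (fun j => pair_count (quad q j) u v) ql).
apply: eq_bigr => i _.
apply: eq_bigr => j _; under eq_bigr => t _ do rewrite !inE /=.
by rewrite (sum_signed b (fun t => (shift t u \in _) && (shift t v \in _))); case: eqP.
Qed.

Lemma sum_ord_eq0 (h : nat) : 0 < h -> \sum_(i < h) (nat_of_ord i == 0) = 1.
Proof. by case: h => // h _; rewrite big_ord_recl big1. Qed.

Lemma sum_ord_lt2 (h : nat) : 1 < h -> \sum_(j < h) (j < 2) = 2.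
Proof. by case: h => [|[|h]] // _; rewrite !big_ord_recl big1. Qed.

(* [i == 0] and [j < 2] say that the i-th edge and the j-th quadruple contain the
   point at infinity. *)
Lemma sum_infinite (b : bool) (h l : nat) : 0 < l -> h = l.*2 ->
  \sum_(i < h) \sum_(j < h)
    (if b == odd (i + j) then (i == 0 :> nat) * (4 - (j < 2))
     else (j < 2) * (2 - (i == 0 :> nat))) + 2 = 8 * l.
Proof.
move=> l0 hl; have l1 : 1 < h by lia.
(* Adding [(i == 0) * (j < 2)] to each cell, 2 in total, cancels the truncated corrections: a cell
   then depends on i alone or on j alone. *)
have two : 2 = \sum_(i < h) \sum_(j < h) (i == 0 :> nat) * (j < 2).
  by rewrite -big_distrlr /= sum_ord_eq0 ?sum_ord_lt2 // ltnW.
rewrite [X in _ + X = _]two -big_split /=.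
under eq_bigr => i _ do rewrite -big_split /=.
transitivity (\sum_(i < h) \sum_(j < h)
  (if b == odd (i + j) then 4 * (i == 0 :> nat) else 2 * (j < 2))).
  apply: eq_bigr => i _; apply: eq_bigr => j _.
  by case: (b == _); case: (i == 0 :> nat); case: (j < 2).
rewrite (sum_checkerboard b (fun i => 4 * (i == 0)) (fun j => 2 * (j < 2)) hl).
by rewrite -!big_distrr /= sum_ord_eq0 ?sum_ord_lt2 ?(ltnW l1) //; lia.
Qed.

Lemma count_blocks_cross (q l : nat) (u v : option (cyc q)) :
  coprime q.*2.+3 3 -> 0 < q -> q.+2 = l.*2 ->
  count (fun B : {set bool * option (cyc q)} => ((true, u) \in B) && ((false, v) \in B))
    [seq block w | w <- enum {: 'I_q.+2 * 'I_q.+2 * cyc q}] = q.*2.+3.*2.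
Proof.
move=> cop3 q0 ql; have uq := uniq_quad cop3 q0.
have l0 : 0 < l by lia.
rewrite count_blocks.
have -> : \sum_(i < q.+2) \sum_(j < q.+2) \sum_t
    ((true, u) \in block (i, j, t)) && ((false, v) \in block (i, j, t)) =
  \sum_(i < q.+2) \sum_(j < q.+2) \sum_(t : cyc q)
    if odd (i + j) then (shift (- t)%R u \in edge q i) * (shift t v \in quad q j)
    else (shift (- t)%R u \in quad q j) * (shift t v \in edge q i).
  apply: eq_bigr => i _; apply: eq_bigr => j _; apply: eq_bigr => t _.
  by rewrite 2!in_set /=; case: (odd _); rewrite mulnb.
case: u v => [x|] [y|].
- transitivity (\sum_(i < q.+2) \sum_(j < q.+2) \sum_(t : cyc q)
    (shift (- t)%R (Some x) \in edge q i) * (shift t (Some y) \in quad q j)).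
    apply: eq_bigr => i _; apply: eq_bigr => j _; case: (odd _) => //.
    (* This involution exchanges x - t and y + t. *)
    have inv : involutive (fun t => x - y - t)%R by move=> t; ring.
    rewrite (reindex_inj (inv_inj inv)) /=; apply: eq_bigr => t _.
    rewrite mulnC (_ : y + (x - y - t) = x - t)%R; last by ring.
    by rewrite (_ : x - (x - y - t) = y + t)%R //; ring.
  under eq_bigr => i _ do rewrite exchange_big /=.
  rewrite exchange_big /=.
  under eq_bigr => t _.
    under eq_bigr => i _ do rewrite -big_distrr /=.
    rewrite -big_distrl /= sum_mem_edge mul1n.
    over.
  by rewrite exchange_big; exact: (sum_shift_quad (Some y)).
- apply/eqP; rewrite -(eqn_add2r 2) (_ : q.*2.+3.*2 + 2 = 8 * l); last by lia.
  rewrite -(sum_infinite false l0 ql) eqn_add2r; apply/eqP.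
  apply: eq_bigr => i _; apply: eq_bigr => j _; case: (odd _) => /=.
    rewrite -big_distrl /= none_in_quad.
    rewrite (sum_signed true (fun t => nat_of_bool (shift t (Some x) \in edge q i))).
    by rewrite sum_shift_some ?uniq_edge // count_edge mulnC.
  rewrite -big_distrl /= none_in_edge.
  rewrite (sum_signed true (fun t => nat_of_bool (shift t (Some x) \in quad q j))).
  by rewrite sum_shift_some ?uq // count_quad mulnC.
- apply/eqP; rewrite -(eqn_add2r 2) (_ : q.*2.+3.*2 + 2 = 8 * l); last by lia.
  rewrite -(sum_infinite true l0 ql) eqn_add2r; apply/eqP.
  apply: eq_bigr => i _; apply: eq_bigr => j _; case: (odd _) => /=.
    by rewrite -big_distrr /= none_in_edge sum_shift_some ?uq // count_quad.
  by rewrite -big_distrr /= none_in_quad sum_shift_some ?uniq_edge // count_edge.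
(* All m translations keep both points, so only the two cells with i = 0 and j < 2 contribute. *)
- transitivity (\sum_(i < q.+2) \sum_(j < q.+2) q.*2.+3 * ((i == 0 :> nat) * (j < 2))).
    apply: eq_bigr => i _; apply: eq_bigr => j _; case: (odd _) => /=.
      by rewrite sum_nat_const card_ord none_in_edge none_in_quad.
    by rewrite sum_nat_const card_ord none_in_edge none_in_quad (mulnC (j < 2)).
  under eq_bigr => i _ do rewrite -!big_distrr /=.
  by rewrite -big_distrr -big_distrl /= sum_ord_eq0 ?sum_ord_lt2 //; lia.
Qed.

(** * The two groups and the assembled design *)

Lemma shiftK (q : nat) (t : cyc q) : cancel (shift t) (shift (- t)%R).
Proof. by case=> [z|] //=; rewrite addrK. Qed.

Lemma shiftNK (q : nat) (t : cyc q) : cancel (shift (- t)%R) (shift t).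
Proof. by case=> [z|] //=; rewrite subrK. Qed.

Definition side (V : finType) (b : bool) : {set bool * V} := [set p | p.1 == b].

Lemma card_side (V : finType) (b : bool) : #|side V b| = #|V|.
Proof.
rewrite -(cardsT V) -[RHS](card_imset _ (f := pair b)); last by move=> u v [].
apply: eq_card => -[c u]; rewrite inE; apply/eqP/imsetP => /= [->|[v _ [-> _]] //].
by exists u; rewrite ?inE.
Qed.

Definition sides (V : finType) : {set {set bool * V}} := [set side V b | b : bool].

Lemma partition_sides (V : finType) (v0 : V) : partition (sides V) [set: bool * V].
Proof.
apply/and3P; split.
- apply/eqP/setP => p; rewrite !inE; apply/bigcupP.
  by exists (side V p.1); rewrite ?inE //; apply: imset_f.
- apply/trivIsetP => _ _ /imsetP[b _ ->] /imsetP[c _ ->] bc.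
  rewrite -setI_eq0; apply/eqP/setP => p; rewrite !inE; apply/negP => /andP[/eqP pb /eqP pc].
  by rewrite -pb -pc eqxx in bc.
- by apply/imsetP => -[b _ /setP/(_ (b, v0))]; rewrite !inE eqxx.
Qed.

Lemma side_inj (V : finType) (v0 : V) : injective (side V).
Proof. by move=> b c /setP/(_ (b, v0)); rewrite !inE eqxx => /esym/eqP. Qed.

Lemma pblock_sides (V : finType) (p : bool * V) : pblock (sides V) p = side V p.1.
Proof.
have /and3P[_ tI _] := partition_sides p.2.
by apply: def_pblock => //; rewrite ?inE //; apply: imset_f.
Qed.

Lemma card_block_side (q : nat) (w : 'I_q.+2 * 'I_q.+2 * cyc q) (b : bool) :
  coprime q.*2.+3 3 -> 0 < q ->
  #|block w :&: side _ b| = if b == odd (w.1.1 + w.1.2) then 2 else 4.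
Proof.
case: w => [[i j] t] cop3 q0 /=.
pose s := if b == odd (i + j) then edge q i else quad q j.
pose c := (if b then - t else t)%R.
have us : uniq s by rewrite /s; case: ifP; rewrite ?uniq_edge ?uniq_quad.
transitivity (size s); last by rewrite /s /quad; case: ifP => // _; case: ltnP.
rewrite -(card_uniqP us) -[RHS](card_imset _ (f := fun a => (b, shift (- c)%R a))); last first.
  by move=> a a' [/(can_inj (shiftNK c))].
apply: eq_card => -[b' a]; rewrite !inE /=; apply/andP/imsetP => /=.
  by move=> [h /eqP e]; move: h; rewrite e => h; exists (shift c a); rewrite ?shiftK.
by move=> [a' sa' [-> ->]]; rewrite eqxx -/c -/s shiftNK.
Qed.

Lemma gdd_exists (l : nat) :
  1 < l -> coprime (4 * l - 1) 3 ->
  exists (T : finType) (G : {set {set T}}) (D : seq {set T}),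
    is_gdd (4 * l) 2 6 (7 * l) (2 * (4 * l - 1)) G D /\ has_configuration 2 4 G D.
Proof.
(* Here n = 4l, so h = 2l and q = h - 2. *)
move=> l1; set q := l.*2 - 2.
have q0 : 0 < q by lia.
have ql : q.+2 = l.*2 by lia.
have -> : 4 * l = q.*2.+4 by lia.
rewrite subn1 /= => cop3.
pose V : finType := option (cyc q).
have cardV : #|V| = q.*2.+4 by rewrite card_option card_ord.
exists (bool * V)%type, (sides V), [seq block w | w <- enum {: 'I_q.+2 * 'I_q.+2 * cyc q}].
split; last first.
  move=> _ /mapP[w _ ->].
  exists (side V (odd (w.1.1 + w.1.2))), (side V (~~ odd (w.1.1 + w.1.2))).
  rewrite !imset_f // !card_block_side // eqxx; split=> //.
    by apply/eqP => /(side_inj None); case: (odd _).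
  by case: (odd _).
split.
- split; first exact: (partition_sides None).
  by rewrite card_imset ?card_bool //; exact: (side_inj None).
- by move=> _ /imsetP[b _ ->]; rewrite card_side.
- move=> _ /mapP[w _ ->].
  rewrite -(cardsID (side V true)) (_ : _ :\: _ = block w :&: side V false); last first.
    by apply/setP => p; rewrite !inE andbC; case: p.1.
  by rewrite !card_block_side //; case: (odd _).
(* The replication number is the case u = v of [count_blocks_same]: m from the edges and 2m from the
   quadruples. *)
- exists (l * (q.*2.+3 + q.*2.+3.*2)) => -[b u].
  transitivity (count (fun B : {set bool * V} => ((b, u) \in B) && ((b, u) \in B))
    [seq block w | w <- enum {: 'I_q.+2 * 'I_q.+2 * cyc q}]).
    by apply: eq_count => B; rewrite andbb.
  rewrite (count_blocks_same b u u ql); congr (_ * (_ + _)).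
    rewrite -[RHS](sum_shift_edge u).
    by apply: eq_bigr => i _; apply: eq_bigr => t _; rewrite andbb.
  rewrite -[RHS](sum_shift_quad u cop3 q0).
  by apply: eq_bigr => i _; apply: eq_bigr => t _; rewrite andbb.
move=> [b u] [c v] uv; rewrite !pblock_sides (inj_eq (side_inj None)) /=.
case: (b =P c) uv => [<- uv|bc _].
  have uv' : u != v by move: uv; rewrite xpair_eqE eqxx.
  by rewrite (count_blocks_same b u v ql) sum_pair_count_edge ?sum_pair_count_quad // mulnC.
rewrite mul2n; case: b c bc => [] [] // _; first exact: count_blocks_cross ql.
rewrite -(count_blocks_cross v u cop3 q0 ql); apply: eq_count => B; exact: andbC.
Qed.

(** * Minimal indices and conclusion *)

(** For n = 8k the index equation reduces to 7k b = a (8k - 1) with coprime coefficients, so 7k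
    divides a and 8k - 1 divides b. *)
Lemma minimal_indices24_mul8 (k : nat) :
  0 < k -> ~~ (7 %| 8 * k - 1) -> minimal_indices24 (8 * k) (7 * k) (8 * k - 1).
Proof.
move=> k0 n7; have [m mE] : exists m, 8 * k = m.+1 by exists (8 * k).-1; lia.
have cop : coprime (7 * k) (8 * k - 1).
  rewrite coprimeMl prime_coprime // n7 /= mE subn1 /=.
  by apply: (@coprime_dvdl _ m.+1); rewrite ?coprimeSn // -mE dvdn_mull.
have mE' : 8 * k - 1 = m by lia.
split.
  rewrite /admissible24 mE'; split; [by lia|by lia|by lia| |].
    have -> : 7 * k * (8 * k) * m + m * (8 * k) ^ 2 = 15 * (2 * (4 * k ^ 2 * m)) by lia.
    by rewrite dvdn_mulr // mulKn // oddM.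
  have -> : 7 * k * m + m * (8 * k) = 5 * (3 * k * m) by lia.
  by rewrite dvdn_mulr.
move=> a b [a0 b0 eq_ab _ _].
have e : 7 * k * b = a * (8 * k - 1) by lia.
split; apply: dvdn_leq => //.
  by rewrite -(Gauss_dvdl _ cop) -e dvdn_mulr.
by rewrite -(@Gauss_dvdr _ (7 * k)) 1?coprime_sym // e dvdn_mull.
Qed.

(* Near-minimality is asserted whenever n - 1 is not a multiple of 7; for the
   other n it is false, see near_minimal24. *)
Theorem corollary5p4 (n : nat) (n_gt0 : 0 < n)
    (n_mod24 : n = 0 %[mod 24] \/ n = 8 %[mod 24]) :
  exists (T : finType) (G : {set {set T}}) (D : seq {set T}),
    [/\ is_gdd n 2 6 (7 * n %/ 4) (2 * (n - 1)) G D,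
        has_configuration 2 4 G D
      & ~~ (7 %| n - 1) -> near_minimal24 n (7 * n %/ 4) (2 * (n - 1))].
Proof.
have [k nE] : exists k, n = 8 * k by exists (n %/ 8); lia.
have k0 : 0 < k by lia.
have -> : 7 * n %/ 4 = 7 * (2 * k) by lia.
have nE4 : n = 4 * (2 * k) by lia.
(* Modulo 3, n is 0 or 2, so 3 does not divide n - 1. *)
have cop3 : coprime (4 * (2 * k) - 1) 3.
  by rewrite coprime_sym prime_coprime //; apply/negP; lia.
have [||T [G [D [gddD confD]]]] := @gdd_exists (2 * k); [by lia|by []|].
exists T, G, D; split; [by rewrite nE4| by [] |].
move=> n7; exists (7 * k), (n - 1); split; [|by lia|by []].
by rewrite nE in n7 *; exact: minimal_indices24_mul8.
Qed.
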